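(* Let $(X,d)$ be a compact metric space, let $\phi$ be a continuous flow on $X$ without fixed points, and let $\mu$ be a Borel probability measure on $X$. Then the following statements are equivalent: (1) $\mu$ is expansive for $\phi$; (2) there exists $\varepsilon\in(0,1)$ such that $\mu(\Gamma^{\varepsilon}_{\varepsilon}(x))=0$ for every $x\in X$; (3) there exists $\varepsilon\in(0,1)$ such that $\mu(\Gamma^{\varepsilon}_{\varepsilon}(x))=0$ for $\mu$-almost every $x\in X$.
   Context: A continuous flow on $X$ is a continuous map $\phi:\mathbb{R}\times X\to X$ with $\phi(0,x)=x$ and $\phi(t+s,x)=\phi(s,\phi(t,x))$; write $\phi_t=\phi(t,\cdot)$. A point $x$ is fixed if $\phi_t(x)=x$ for all $t\in\mathbb{R}$. Let $\mathcal{C}^0$ be the set of continuous functions $h:\mathbb{R}\to\mathbb{R}$ with $h(0)=0$. For $x\in X$ and $\varepsilon>0$ put $$\tilde\Gamma_\varepsilon(x)=\{y\in X:\ \exists h\in\mathcal{C}^0 \text{ such that } d(\phi_s(x),\phi_{h(s)}(y))\le\varepsilon\ \ \forall s\in\mathbb{R}\}.$$ A Borel probability measure $\mu$ (not required to be $\phi$-invariant) is called expansive for $\phi$ if there exists $\varepsilon>0$ such that $\mu(\tilde\Gamma_\varepsilon(x))=0$ for every $x\in X$. Since $\tilde\Gamma_\varepsilon(x)$ need not be Borel, the convention is: for an arbitrary $A\subseteq X$, $\mu(A)=0$ means $\mu(B)=0$ for every Borel set $B\subseteq A$. Let $Rep$ be the set of increasing homeomorphisms $h:\mathbb{R}\to\mathbb{R}$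 with $h(0)=0$, and for $\alpha\in(0,1)$ let $$Rep(\alpha)=\left\{h\in Rep:\ \left|\frac{h(s)-h(t)}{s-t}-1\right|\le\alpha\ \ \forall s\ne t\right\}.$$ For $x\in X$, $\alpha\in(0,1)$, $\varepsilon>0$, $$\Gamma^{\alpha}_{\varepsilon}(x)=\{y\in X:\ \exists h\in Rep(\alpha)\text{ such that } d(\phi_s(x),\phi_{h(s)}(y))\le\varepsilon\ \ \forall s\in\mathbb{R}\}.$$ *)

(* Defs.v *)
From HB Require Import structures.
From mathcomp Require Import all_boot all_order all_algebra.
From mathcomp Require Import all_classical all_reals all_analysis.
Set Implicit Arguments.
Unset Strict Implicit.
Unset Printing Implicit Defensive.
Import Order.TTheory GRing.Theory Num.Theory.
Import numFieldNormedType.Exports.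
Local Open Scope classical_set_scope.
Local Open Scope ring_scope.

(* Measurable types of the library are pointed.  The distinguished point is
   arbitrary and plays no other role; a space that carries a probability
   measure is nonempty anyway. *)
#[short(type="pmetricType")]
HB.structure Definition PointedMetric (K : numDomainType) :=
  {T of Metric K T & Pointed T}.

Notation borelType X := (g_sigma_algebraType (@open X)).

Section Flows.
Context {R : realType} {X : metricType R}.
Implicit Types (phi : R -> X -> X) (x : X).

Definition continuous_flow phi : Prop :=
  [/\ continuous (fun p : R * X => phi p.1 p.2),
      forall x, phi 0 x = x
    & forall t s x, phi (t + s) x = phi s (phi t x)].

Definition fixed_point phi x : Prop := forall t, phi t x = x.

Definition C0 : set (R -> R) := [set h | continuous h /\ h 0 = 0].

Definition increasing_homeo (h : R -> R) : Prop :=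
  {homo h : s t / s < t} /\
  exists g : R -> R, [/\ cancel h g, cancel g h, continuous h & continuous g].

Definition Rep : set (R -> R) := [set h | increasing_homeo h /\ h 0 = 0].

Definition RepA (alpha : R) : set (R -> R) :=
  [set h | Rep h /\
    forall s t, s != t -> `|(h s - h t) / (s - t) - 1| <= alpha].

Definition tracking_set phi (H : set (R -> R)) (eps : R) x : set X :=
  [set y | exists2 h, H h & forall s, mdist (phi s x) (phi (h s) y) <= eps].

Definition Gamma_tilde phi (eps : R) x : set X := tracking_set phi C0 eps x.

Definition Gamma phi (alpha eps : R) x : set X :=
  tracking_set phi (RepA alpha) eps x.

End Flows.

(* For a possibly nonmeasurable A; on measurable sets it is mu A = 0, but in
   general it is weaker than mu.-negligible, which asks for a measurable
   superset of measure zero. *)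
Definition inner_null d (T : measurableType d) (R : realType)
    (mu : set T -> \bar R) (A : set T) : Prop :=
  forall B, measurable B -> B `<=` A -> mu B = 0%E.

Definition expansive_measure (R : realType) (X : pmetricType R)
    (phi : R -> X -> X) (mu : probability (borelType X) R) : Prop :=
  exists2 eps : R, 0 < eps & forall x : X, inner_null mu (Gamma_tilde phi eps x).

(* Main.v *)
Require Import Defs.
From mathcomp Require Import all_boot all_order all_algebra.
From mathcomp Require Import all_classical all_reals all_analysis.
From mathcomp Require Import ring lra.
Import Order.TTheory GRing.Theory Num.Theory.
Import numFieldNormedType.Exports.
Local Open Scope classical_set_scope.
Local Open Scope ring_scope.

(** All three notions say that the points which track [x] up to a time change
    form a null set; they differ in the time changes allowed and in which [x]
    are quantified over.  Passing from (1) to (2) only shrinks the tracking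
    sets, and (2) trivially gives (3), so the content is in (3) => (1).  It
    combines two facts.

    - Null at almost every center implies null at every center, at a quarter
      of the scale ([Gamma_common_center]).  If [y] and [z] both track [x] with
      parameter [e / 4], then inverting one time change and composing it with
      the other shows that [z] tracks [y] with parameter [e].  A Borel subset
      of the tracking set of [x] that had positive measure would contain a
      good center [y], and would then lie in the null tracking set of [y].

    - At small scale a merely continuous time change can be replaced by one
      that is bi-Lipschitz with constants close to 1 ([Gamma_tilde_sub_Gamma]).
      Compactness and the absence of fixed points bound the periods of the flow
      from below, so for a short time [c] the maps [phi c] and [phi (- c)]
      displace all points by a uniform amount.  Suppose [phi (h s) y] stays
      close to [phi s x].  Restart the two orbits at time [s] and wait for
      [u <= T]: by uniform continuity the orbit of [y] run for time [u] is
      still close to that of [x], hence close to itself run for time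
      [h (s + u) - h s].  The discrepancy between these two times is continuous
      in [u], vanishes at [u = 0] and cannot cross [c] or [- c], where the
      displacement would be too large ([tracking_time_change_drift]).  Hence
      [k s = h s - s] varies by at most [e * T] on intervals of length [T], so
      it is [e]-Lipschitz up to the additive error [e * T]
      ([coarse_lipschitz]).  Its inf-convolution with [e * |.|] is a genuinely
      [e]-Lipschitz function within [e * T] of [k]
      ([coarse_lipschitz_approx]); adding it to the identity and normalizing at
      0 gives the new time change, and the flow hardly moves points during the
      time by which the two time changes differ. *)

(** * Bi-Lipschitz time changes *)

Lemma lipschitz_continuous (R : realType) (C : R) (f : R -> R) :
  0 < C -> (forall s t, `|f s - f t| <= C * `|s - t|) -> continuous f.
Proof.
move=> C0 fC x; apply/cvgrPdist_le => e e0.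
near=> y; apply: le_trans (fC _ _) _.
rewrite mulrC -ler_pdivlMr//.
near: y; apply: cvgr_dist_le; [exact: cvg_id|exact: divr_gt0].
Unshelve. all: by end_near. Qed.

(** For [a < 1] the slope condition already makes [h] an increasing
    homeomorphism: it bounds the slopes of [h] away from 0 and infinity, so [h]
    is increasing and Lipschitz, is onto by the intermediate value theorem, and
    has a Lipschitz inverse. *)
Lemma RepAP (R : realType) (a : R) (h : R -> R) : 0 <= a -> a < 1 ->
  RepA a h <->
  h 0 = 0 /\ forall s t, `|(h s - h t) - (s - t)| <= a * `|s - t|.
Proof.
move=> a0 a1; split=> [[[_ h0] ha]|[h0 ha]].
  split=> // s t; have [->|st] := eqVneq s t.
    by rewrite !subrr normr0 mulr0.
  have st0 : s - t != 0 by rewrite subr_eq0.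
  have -> : h s - h t - (s - t) = ((h s - h t) / (s - t) - 1) * (s - t).
    by field.
  by rewrite normrM ler_wpM2r// ha.
have low s t : (1 - a) * `|s - t| <= `|h s - h t|.
  have := lerB_dist (s - t) (h s - h t).
  by have := ha s t; rewrite (distrC (s - t) (h s - h t)); lra.
have hcont : continuous h.
  apply: (@lipschitz_continuous _ (1 + a)); first by lra.
  move=> s t; have := lerB_dist (h s - h t) (s - t).
  by have := ha s t; lra.
have hmono : {homo h : s t / s < t}.
  move=> s t st; have := ha t s; have st0 : 0 < t - s by rewrite subr_gt0.
  rewrite (gtr0_norm st0) ler_norml => /andP[+ _].
  have : 0 < (1 - a) * (t - s) by rewrite mulr_gt0// subr_gt0.
  by lra.
have hsurj y : exists x, h x = y.
  (* Slopes are at least 1 - a, so h has left [- |y|, |y|] at time M. *)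
  pose M := `|y| / (1 - a).
  have Mnng : 0 <= M by rewrite divr_ge0// subr_ge0 ltW.
  have yM : `|y| = (1 - a) * M.
    by rewrite mulrCA mulfV ?mulr1// gt_eqF// subr_gt0.
  have hM : `|y| <= h M.
    have := ha M 0; rewrite h0 !subr0 (ger0_norm Mnng) ler_norml => /andP[+ _].
    by lra.
  have hNM : h (- M) <= - `|y|.
    have := ha (- M) 0; rewrite h0 !subr0 normrN (ger0_norm Mnng) ler_norml.
    by move=> /andP[_]; lra.
  have yb : - `|y| <= y <= `|y| by rewrite -ler_norml.
  have [|||x _ <-] := @IVT _ h (- M) M y; last by exists x.
  - by lra.
  - exact: continuous_subspaceT.
  - by rewrite ge_min le_max; apply/andP; split; apply/orP; [left|right]; lra.
have [g gh] := choice hsurj.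
have hg : cancel h g.
  move=> x; have /eqP := low (g (h x)) x; rewrite gh subrr normr0 => /eqP H.
  apply/eqP; rewrite -subr_eq0 -normr_eq0 eq_le normr_ge0 andbT.
  by rewrite -(pmulr_rle0 (x := 1 - a)) ?subr_gt0.
split; last first.
  move=> s t st; have st0 : s - t != 0 by rewrite subr_eq0.
  have -> : (h s - h t) / (s - t) - 1 = (h s - h t - (s - t)) / (s - t).
    by field.
  by rewrite normrM normfV ler_pdivrMr ?normr_gt0.
split=> //; split=> //; exists g; split=> //.
apply: (@lipschitz_continuous _ (1 - a)^-1); first by rewrite invr_gt0 subr_gt0.
move=> s t; rewrite mulrC ler_pdivlMr ?subr_gt0// mulrC.
by have := low (g s) (g t); rewrite !gh.
Qed.

(** * Regularizing functions that are Lipschitz at large scale *)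

(** Cut the interval between [s] and [t] into steps of length at most [T]; at
    most [|s - t| / T + 1] of them are needed. *)
Lemma coarse_lipschitz (R : realType) (eta T : R) (k : R -> R) : 0 < T ->
  (forall s t, `|s - t| <= T -> `|k s - k t| <= eta * T) ->
  forall s t, `|k s - k t| <= eta * `|s - t| + eta * T.
Proof.
move=> T0 kT.
have eta0 : 0 <= eta.
  have := kT 0 0; rewrite !subrr normr0 => /(_ (ltW T0)).
  by rewrite pmulr_lge0.
have steps (n : nat) s t : `|s - t| <= n%:R * T ->
    `|k s - k t| <= n%:R * (eta * T).
  elim: n s t => [|n IH] s t.
    by rewrite !mul0r normr_le0 subr_eq0 => /eqP ->; rewrite subrr normr0.
  (* One step from s to m, and n steps of the same length from m to t. *)
  move=> st; pose m := s + (t - s) / n.+1%:R.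
  have n0 : (n.+1%:R : R) != 0 by rewrite pnatr_eq0.
  have nn : (n.+1%:R : R) = n%:R + 1 by rewrite -natr1.
  have sm : s - m = (s - t) / n.+1%:R by rewrite /m; field.
  have mt : m - t = (s - t) / n.+1%:R * n%:R.
    by rewrite /m; move: n0; rewrite nn => n0; field.
  have st' : `|s - t| / n.+1%:R <= T by rewrite ler_pdivrMr ?ltr0Sn// mulrC.
  apply: le_trans (ler_distD (k m) _ _) _.
  rewrite -natr1 mulrDl mul1r addrC lerD//.
    apply: IH; rewrite mt !normrM normfV !normr_nat mulrC ler_wpM2l//.
  by apply: kT; rewrite sm normrM normfV normr_nat.
move=> s t; pose n := Num.truncn (`|s - t| / T).
have x0 : 0 <= `|s - t| / T by rewrite divr_ge0// ltW.
have /andP[nle ltn] := truncn_itv x0.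
have := @steps n.+1 s t; rewrite -ler_pdivrMr// (ltW ltn) => /(_ isT) H.
apply: le_trans H _.
rewrite -natr1 mulrDl mul1r lerD2r mulrCA ler_wpM2l//.
by rewrite -ler_pdivlMr.
Qed.

(** The function [g s = inf_t (k t + eta * |s - t|)], the inf-convolution of [k]
    with [eta * |.|], is [eta]-Lipschitz as an infimum of [eta]-Lipschitz
    functions of [s]; taking [t = s] bounds it above by [k], and the hypothesis
    bounds each competitor from below by [k s - c]. *)
Lemma coarse_lipschitz_approx (R : realType) (eta c : R) (k : R -> R) :
  0 <= eta ->
  (forall s t, `|k s - k t| <= eta * `|s - t| + c) ->
  exists g : R -> R, (forall s t, `|g s - g t| <= eta * `|s - t|) /\
    forall s, k s - c <= g s <= k s.
Proof.
move=> eta0 kc.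
pose E s := range (fun t => k t + eta * `|s - t|).
have E0 s : E s !=set0 by exists (k 0 + eta * `|s - 0|); exists 0.
have lbE s : lbound (E s) (k s - c).
  move=> _ [t _ <-]; have := kc s t; rewrite ler_norml => /andP[_].
  by lra.
have hlE s : has_lbound (E s) by exists (k s - c).
exists (fun s => inf (E s)).
have half s t : inf (E s) - inf (E t) <= eta * `|s - t|.
  rewrite lerBlDl -lerBlDr; apply: lb_le_inf => // _ [r _ <-].
  rewrite lerBlDr; apply: (@le_trans _ _ (k r + eta * `|s - r|)).
    by apply: ge_inf => //; exists r.
  rewrite -addrA lerD2l -mulrDr ler_wpM2l// [leRHS]addrC.
  exact: ler_distD.
split=> [s t|s].
  by rewrite ler_norml half andbT lerNl opprB distrC half.
apply/andP; split; first exact: lb_le_inf.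
by apply: ge_inf => //; exists s => //; rewrite subrr normr0 mulr0 addr0.
Qed.

(** * Uniform estimates for a flow on a compact space *)

Section flow.
Context {R : realType} {X : metricType R} (phi : R -> X -> X).
Hypothesis cptX : compact [set: X].
Hypothesis flow_phi : continuous_flow phi.

Let phi0 x : phi 0 x = x. Proof. by case: flow_phi. Qed.
Let phiD t s x : phi (t + s) x = phi s (phi t x). Proof. by case: flow_phi. Qed.

Lemma flow_continuousW u p (e : R) : 0 < e -> exists2 r : R, 0 < r &
  forall v q, `|u - v| < r -> mdist p q < r -> mdist (phi u p) (phi v q) < e.
Proof.
move=> e0; have [cphi _ _] := flow_phi.
have /cvg_ballP/(_ e e0)/nbhs_ballP[r /= r0 sub] := cphi (u, p).
exists r => // v q uv pq.
have := sub (v, q); rewrite /= ballEmdist; apply.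
by split => //=; rewrite ballEmdist.
Qed.

(** Used with [K] a point, where it says that a short time moves all points
    little, and with [K] a segment, where it says that nearby orbits stay close
    during a bounded time. *)
Lemma flow_unif_continuous (K : set R) (e : R) : compact K -> 0 < e ->
  exists2 d : R, 0 < d & forall u p v q, K u -> `|u - v| <= d ->
    mdist p q <= d -> mdist (phi u p) (phi v q) <= e.
Proof.
move=> cK e0.
have /compact_near_coveringP cov := compact_setX cK cptX.
pose P (d : R) (z : R * X) := forall v q, `|z.1 - v| <= d ->
    mdist z.2 q <= d -> mdist (phi z.1 z.2) (phi v q) <= e.
have near_P : \forall d \near (0 : R)^'+, (K `*` setT) `<=` P d.
  apply: cov => -[u p] _; have e2 : 0 < e / 2 by rewrite divr_gt0.
  have [r r0 ur] := flow_continuousW u p _ e2.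
  exists (ball (u, p) (r / 2), [set d | d < r / 2]) => /=.
    split; first by apply: nbhsx_ballx; rewrite divr_gt0.
    by apply: nbhs_right_lt; rewrite divr_gt0.
  move=> [[u' p'] d] /= [[/= uu' pp'] dr] v q /= u'v p'q.
  rewrite ballEmdist /= in pp'; rewrite /ball/= in uu'.
  have h1 : mdist (phi u p) (phi u' p') < e / 2 by apply: ur; lra.
  have h2 : mdist (phi u p) (phi v q) < e / 2.
    apply: ur.
      by apply: le_lt_trans (ler_distD u' _ _) _; lra.
    by apply: le_lt_trans (metric_triangle _ p' _) _; lra.
  apply: le_trans (metric_triangle _ (phi u p) _) _.
  by rewrite (metric_sym (phi u' p')); lra.
have [d [d0 Pd]] := filter_ex (filterI (nbhs_right_gt (0 : R)) near_P).
by exists d => // u p v q Ku uv pq; apply: (Pd (u, p)).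
Qed.

Lemma small_time_displacement (e : R) : 0 < e ->
  exists2 d : R, 0 < d & forall t p, `|t| <= d -> mdist p (phi t p) <= e.
Proof.
move=> e0.
have [d d0 H] := flow_unif_continuous [set 0] e (@compact_set1 _ 0) e0.
exists d => // t p td; rewrite -[X in mdist X _](phi0 p).
by apply: H => //; rewrite ?sub0r ?normrN// mdistxx ltW.
Qed.

(** If [phi t0 x != x], then no point [y] near [x] has a small period [t]:
    reducing [t0] modulo [t] would write [phi t0 y] as [phi r y] with
    [|r| <= |t|], too close to [y] since [phi t0 y] is near [phi t0 x].
    Compactness makes the bound on [t] uniform. *)
Lemma no_short_period : (forall x, ~ fixed_point phi x) ->
  exists2 T : R, 0 < T & forall t x, 0 < `|t| <= T -> phi t x <> x.
Proof.
move=> nofix.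
have /compact_near_coveringP cov := cptX.
pose P (d : R) x := forall t, 0 < `|t| <= d -> phi t x <> x.
suff near_P : \forall d \near (0 : R)^'+, setT `<=` P d.
  have [d [d0 Pd]] := filter_ex (filterI (nbhs_right_gt (0 : R)) near_P).
  by exists d => // t x; apply: Pd.
apply: cov => x _.
have /existsNP[t0 /eqP t0x] := nofix x.
pose a := mdist x (phi t0 x).
have a0 : 0 < a by rewrite mdist_gt0 eq_sym.
have a4 : 0 < a / 4 by rewrite divr_gt0.
have [d d0 small] := small_time_displacement _ a4.
have [r r0 t0r] := flow_continuousW t0 x _ a4.
pose r' := Num.min r (a / 4).
have r'0 : 0 < r' by rewrite lt_min r0.
exists (ball x r', [set u | u < d]) => /=.
  by split; [exact: nbhsx_ballx|exact: nbhs_right_lt].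
move=> [y u] /= [xy ud] t /andP[t_gt0 tu] ty.
rewrite ballEmdist /= lt_min in xy; case/andP: xy => xyr xya.
have tn0 : t != 0 by rewrite -normr_gt0.
have period (n : nat) : phi (n%:R * t) y = y.
  elim: n => [|n IH]; first by rewrite mul0r phi0.
  by rewrite -natr1 mulrDl mul1r phiD IH.
have periodN (n : nat) : phi (- (n%:R * t)) y = y.
  by rewrite -[in LHS](period n) -phiD subrr phi0.
have periodz (n : int) : phi (n%:~R * t) y = y.
  case: n => n; first exact: period.
  by rewrite NegzE mulrNz mulNr; exact: periodN.
pose n := Num.floor (t0 / t).
have rest : `|t0 - n%:~R * t| <= d.
  have -> : t0 - n%:~R * t = (t0 / t - n%:~R) * t by field.
  have /andP[n1 n2] := floor_itv (t0 / t); rewrite -/n intrD in n1 n2.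
  rewrite normrM ger0_norm ?subr_ge0//.
  apply: le_trans (_ : `|t| <= d); last by lra.
  by rewrite ler_piMl//; move: n2; lra.
have : phi t0 y = phi (t0 - n%:~R * t) y.
  by rewrite -{2}(periodz n) -phiD addrC subrK.
have := small _ y rest => /[swap] <- yt0.
have xt0 : mdist (phi t0 x) (phi t0 y) < a / 4.
  by apply: t0r; rewrite // subrr normr0.
have : a <= mdist x y + mdist y (phi t0 y) + mdist (phi t0 x) (phi t0 y).
  rewrite (metric_sym (phi t0 x)).
  apply: le_trans (metric_triangle _ (phi t0 y) _) _; rewrite lerD2r.
  exact: metric_triangle.
by lra.
Qed.

Lemma displacement_lower_bound c : (forall x, phi c x <> x) ->
  exists2 g : R, 0 < g & forall x, g < mdist x (phi c x).
Proof.
move=> nfix; have /compact_near_coveringP cov := cptX.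
suff near_P : \forall g \near (0 : R)^'+,
    setT `<=` [set x | g < mdist x (phi c x)].
  have [g [g0 Pg]] := filter_ex (filterI (nbhs_right_gt (0 : R)) near_P).
  by exists g => // x; apply: Pg.
apply: (cov _ _ (fun g x => g < mdist x (phi c x))) => x _.
pose a := mdist x (phi c x).
have a0 : 0 < a by rewrite mdist_gt0 eq_sym; apply/eqP.
have a4 : 0 < a / 4 by rewrite divr_gt0.
have [r r0 cr] := flow_continuousW c x _ a4.
pose r' := Num.min r (a / 4).
have r'0 : 0 < r' by rewrite lt_min r0.
exists (ball x r', [set u | u < a / 4]) => /=.
  by split; [exact: nbhsx_ballx|exact: nbhs_right_lt].
move=> [y u] /= [xy ua].
rewrite ballEmdist /= lt_min in xy; case/andP: xy => xyr xya.
have xc : mdist (phi c x) (phi c y) < a / 4.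
  by apply: cr; rewrite // subrr normr0.
have : a <= mdist x y + mdist y (phi c y) + mdist (phi c x) (phi c y).
  rewrite (metric_sym (phi c x)).
  apply: le_trans (metric_triangle _ (phi c y) _) _; rewrite lerD2r.
  exact: metric_triangle.
by lra.
Qed.

(** * Time changes of tracking orbits *)

(** The drift [h s - s] of a time change that tracks closely moves by at most
    [c] during time [T]: in order to exceed [c] it would have to pass through a
    value [c] or [- c], at which the flow displaces every point by more than
    the tracking error allows. *)
Lemma tracking_time_change_drift (T c : R) : 0 < T -> 0 < c ->
  (forall x, phi c x <> x) -> (forall x, phi (- c) x <> x) ->
  exists2 d : R, 0 < d & forall x y (h : R -> R), continuous h ->
    (forall s, mdist (phi s x) (phi (h s) y) <= d) ->
    forall s t, `|s - t| <= T -> `|(h s - s) - (h t - t)| <= c.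
Proof.
move=> T0 c0 cn cNn.
have [g1 g10 g1P] := displacement_lower_bound _ cn.
have [g2 g20 g2P] := displacement_lower_bound _ cNn.
pose g := Num.min g1 g2.
have g0 : 0 < g by rewrite lt_min g10.
have g2_gt0 : 0 < g / 2 by rewrite divr_gt0.
have [d d0 dP] := flow_unif_continuous `[0, T] _ (@segment_compact _ 0 T) g2_gt0.
exists (Num.min d (g / 2)); first by rewrite lt_min d0.
move=> x y h hc hd.
suff fwd s u : 0 <= u <= T -> `|(h (s + u) - (s + u)) - (h s - s)| <= c.
  move=> s t; have [st|/ltW ts] := leP s t => stT.
    rewrite distrC; have := fwd s (t - s); rewrite (addrC s) subrK; apply.
    by move: stT; rewrite distrC ger0_norm subr_ge0// => ->; rewrite st.
  have := fwd t (s - t); rewrite (addrC t) subrK; apply.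
  by move: stT; rewrite ger0_norm subr_ge0// => ->; rewrite ts.
move=> /andP[u0 uT].
pose k r := (h (s + r) - (s + r)) - (h s - s).
have kc : continuous k.
  move=> r; apply: cvgB; last exact: cvg_cst.
  apply: cvgB; last by apply: cvgD; [exact: cvg_cst|exact: cvg_id].
  apply: (continuous_comp (f := fun r => s + r) (g := h)); last exact: hc.
  by apply: cvgD; [exact: cvg_cst|exact: cvg_id].
have k0 : k 0 = 0 by rewrite /k addr0 subrr.
(* The orbit of y run for time r is compared with itself run for the time
   prescribed by h, through the orbit of x. *)
have close r : 0 <= r <= T ->
    mdist (phi (h s + r) y) (phi (k r) (phi (h s + r) y)) <= g.
  move=> rT.
  have -> : phi (k r) (phi (h s + r) y) = phi (h (s + r)) y.
    by rewrite -phiD; congr phi; rewrite /k; ring.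
  apply: le_trans (metric_triangle _ (phi r (phi s x)) _) _.
  rewrite -phiD (splitr g) lerD//; last first.
    by apply: le_trans (hd _) _; rewrite ge_min lexx orbT.
  rewrite !phiD metric_sym; apply: dP => //; first by rewrite subrr normr0 ltW.
  by apply: le_trans (hd _) _; rewrite ge_min lexx.
have away r : 0 <= r <= T -> k r <> c /\ k r <> - c.
  move=> /close H; split=> krc; move: H; rewrite krc leNgt => /negP; apply.
    by apply: le_lt_trans (g1P _); rewrite ge_min lexx.
  by apply: le_lt_trans (g2P _); rewrite ge_min lexx orbT.
have sub r : r \in `[0, u] -> 0 <= r <= T.
  by rewrite in_itv /= => /andP[-> ru]; apply: le_trans uT.
have ivt v : Num.min (k 0) (k u) <= v <= Num.max (k 0) (k u) ->
    exists2 r, 0 <= r <= T & k r = v.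
  move=> /(IVT u0 (continuous_subspaceT kc))[r ru <-].
  by exists r => //; exact: sub.
rewrite -/(k u) ler_norml; apply/andP; split; rewrite leNgt; apply/negP => kuc.
  have [|r rT krc] := ivt (- c); last by have [] := away r rT.
  by rewrite k0 ge_min le_max (ltW kuc) orbT lerNl oppr0 ltW.
have [|r rT krc] := ivt c; last by have [] := away r rT.
by rewrite k0 ge_min le_max (ltW kuc) orbT ltW.
Qed.

(** The drift of [h] is replaced by its Lipschitz regularization.  The window
    [T] is chosen so short that the drift bound [e * T] is less than all
    periods, and that the flow displaces points by at most [e / 2] during
    the time by which the old and new time changes differ, again at most
    [e * T]. *)
Lemma Gamma_tilde_sub_Gamma (e : R) : (forall x, ~ fixed_point phi x) ->
  0 < e < 1 ->
  exists2 d : R, 0 < d & forall x, Gamma_tilde phi d x `<=` Gamma phi e e x.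
Proof.
move=> nofix /andP[e0 e1].
have e2 : 0 < e / 2 by rewrite divr_gt0.
have [T0 T00 T0P] := no_short_period nofix.
have [b b0 bP] := small_time_displacement _ e2.
pose T := Num.min T0 b.
have Tpos : 0 < T by rewrite lt_min T00.
have TT0 : T <= T0 by rewrite ge_min lexx.
have Tb : T <= b by rewrite ge_min lexx orbT.
have c0 : 0 < e * T by rewrite mulr_gt0.
have cT : e * T <= T by rewrite ler_piMl// ltW.
have [||d d0 dP] := tracking_time_change_drift _ _ Tpos c0.
- by move=> x; apply: T0P; rewrite gtr0_norm// c0 (le_trans cT).
- by move=> x; apply: T0P; rewrite normrN gtr0_norm// c0 (le_trans cT).
exists (Num.min d (e / 2)); first by rewrite lt_min d0.
move=> x y [h [hc h0] hd].
have {}dP : forall s t, `|s - t| <= T -> `|(h s - s) - (h t - t)| <= e * T.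
  by apply: dP hc _ => s; apply: le_trans (hd s) _; rewrite ge_min lexx.
have kl := coarse_lipschitz _ _ _ _ Tpos dP.
have [k [klip kclose]] := coarse_lipschitz_approx _ _ _ _ (ltW e0) kl.
exists (fun s => s + (k s - k 0)).
  apply/RepAP => //; first exact: ltW.
  split=> [|s t]; first by rewrite subrr addr0.
  apply: le_trans (klip s t); rewrite le_eqVlt; apply/orP; left; apply/eqP.
  by congr `|_|; ring.
move=> s; pose r := s + (k s - k 0) - h s.
have -> : phi (s + (k s - k 0)) y = phi r (phi (h s) y).
  by rewrite -phiD; congr phi; rewrite /r; ring.
apply: le_trans (metric_triangle _ (phi (h s) y) _) _.
rewrite (splitr e) lerD//.
  by apply: le_trans (hd s) _; rewrite ge_min lexx orbT.
apply: bP; have := kclose s; have := kclose 0.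
rewrite h0 subrr => /andP[? ?] /andP[? ?].
by rewrite ler_norml /r; apply/andP; split; lra.
Qed.

Lemma Gamma_sub_Gamma_tilde (a d e : R) x : d <= e ->
  Gamma phi a d x `<=` Gamma_tilde phi e x.
Proof.
move=> de y [h [[[_ [g [_ _ hc _]]] h0] _] hd]; exists h => // s.
exact: le_trans (hd s) de.
Qed.

(** If [hy] and [hz] are the time changes for [y] and [z], then
    [hz \o hy^-1] serves for the pair [y], [z]; its slopes deviate from 1 by at
    most [2 * a / (1 - a)] with [a = e / 4], which is less than [e]. *)
Lemma Gamma_common_center (e : R) x y z : 0 < e < 1 ->
  Gamma phi (e / 4) (e / 4) x y -> Gamma phi (e / 4) (e / 4) x z ->
  Gamma phi e e y z.
Proof.
move=> /andP[e0 e1] [hy hyR hyd] [hz hzR hzd].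
have e40 : 0 <= e / 4 by lra.
have e41 : e / 4 < 1 by lra.
have [[[_ [g [hyg ghy _ _]]] hy0] _] := hyR.
have [_ hya] := (RepAP _ _ hy e40 e41).1 hyR.
have [hz0 hza] := (RepAP _ _ hz e40 e41).1 hzR.
have g0 : g 0 = 0 by rewrite -hy0 hyg.
exists (hz \o g); last first.
  move=> s /=; have := hyd (g s); have := hzd (g s); rewrite ghy => h1 h2.
  apply: le_trans (metric_triangle _ (phi (g s) x) _) _.
  by rewrite metric_sym; lra.
apply/RepAP => //; first exact: ltW.
split=> [|s t] /=; first by rewrite g0.
have := hya (g s) (g t); have := hza (g s) (g t); rewrite !ghy => h1 h2.
have low := lerB_dist (g s - g t) (s - t).
rewrite (distrC (g s - g t)) in low.
apply: le_trans (ler_distD (g s - g t) _ _) _.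
rewrite (distrC (g s - g t)).
have : e / 4 * `|g s - g t| * 2 <= e * `|s - t|; last by lra.
have : `|g s - g t| <= 2 * `|s - t| by have := normr_ge0 (g s - g t); nra.
by nra.
Qed.

End flow.

(** * The equivalence *)

Lemma inner_nullS d (T : measurableType d) (R : realType)
    (mu : set T -> \bar R) (A B : set T) :
  A `<=` B -> inner_null mu B -> inner_null mu A.
Proof. by move=> AB muB C mC CA; apply: muB => // x /CA/AB. Qed.

Theorem theorem1 (R : realType) (X : pmetricType R) (phi : R -> X -> X)
    (mu : probability (borelType X) R) :
  compact [set: X] ->
  continuous_flow phi ->
  (forall x : X, ~ fixed_point phi x) ->
  [<-> expansive_measure phi mu;
       exists eps : R, 0 < eps < 1 /\
         (forall x : X, inner_null mu (Gamma phi eps eps x));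
       exists eps : R, 0 < eps < 1 /\
         (\forall x \ae mu, inner_null mu (Gamma phi eps eps x))].
Proof.
move=> cptX flow nofix; tfae.
- move=> [e e0 mue]; exists (Num.min e (1 / 2)); split.
    by rewrite lt_min e0 gt_min; apply/andP; split; [|apply/orP; right]; lra.
  move=> x; apply: inner_nullS (mue x).
  by apply: Gamma_sub_Gamma_tilde; rewrite // ge_min lexx.
- move=> [e [e01 mue]]; exists e; split=> //.
  exact: aeW.
- move=> [e [e01 [N [mN muN0 subN]]]].
  have null x : inner_null mu (Gamma phi (e / 4) (e / 4) x).
    move=> B mB Bx; have [BN|] := pselect (B `<=` N).
      by apply: (subset_measure0 mB mN BN).
    (* B is not inside the exceptional null set N, so it has a good center. *)
    move=> /existsNP[y /not_implyP[By nNy]].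
    have muy : inner_null mu (Gamma phi e e y) by apply: contrapT => /subN.
    apply: muy => // z Bz.
    exact: (Gamma_common_center _ _ _ _ _ e01 (Bx _ By) (Bx _ Bz)).
  have e41 : 0 < e / 4 < 1 by case/andP: e01 => *; apply/andP; split; lra.
  have [d d0 sub] := Gamma_tilde_sub_Gamma _ cptX flow _ nofix e41.
  by exists d => // x; apply: inner_nullS (null x); exact: sub.
Qed.
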